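(* Let $k$ be an algebraically closed field of characteristic $0$ and $R=k\langle x,y\mid xy-yx=y^2\rangle$. All ($k$-algebra) automorphisms of $R$ are of the form $x\mapsto \alpha x+p(y)$, $y\mapsto\alpha y$, where $\alpha\in k\setminus\{0\}$ and $p\in k[y]$ is a polynomial in $y$. Hence the group of automorphisms of $R$ is isomorphic to a semidirect product of the additive group of polynomials $k[y]$ (the normal subgroup) and the multiplicative group $k^*$ of the field: $\mathrm{Aut}(R)\simeq k[y]\rtimes k^*$. *)

(* Defs.v *)
From HB Require Import structures.
From mathcomp Require Import all_boot all_algebra.
From mathcomp Require Import monalg boolp.

Set Implicit Arguments.
Unset Strict Implicit.
Unset Printing Implicit Defensive.

Import GRing.Theory.
Local Open Scope ring_scope.
Local Open Scope quotient_scope.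

Section PrincipalQuotient.
Variables (k : fieldType) (A : algType k) (r : A).

(* The two-sided ideal A r A: finite sums of the a r b. *)
Definition ideal2 (u : A) : bool :=
  `[< exists s : seq (A * A), u = \sum_(ab <- s) ab.1 * r * ab.2 >].

Lemma ideal2_zmod_closed : zmod_closed ideal2.
Proof.
split=> [|u v /asboolP[s ->] /asboolP[t ->]]; apply/asboolP.
  by exists [::]; rewrite big_nil.
exists (s ++ [seq (- ab.1, ab.2) | ab <- t]).
rewrite big_cat big_map -sumrN; congr (_ + _).
by apply: eq_bigr => ab _; rewrite !mulNr.
Qed.

HB.instance Definition _ := GRing.isZmodClosed.Build A ideal2 ideal2_zmod_closed.
Definition ideal2_zmod : zmodClosed A := GRing.ZmodClosed.clone A ideal2 _.

Lemma ideal2Ml a u : u \in ideal2 -> a * u \in ideal2.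
Proof.
move=> /asboolP[s ->]; apply/asboolP.
exists [seq (a * bc.1, bc.2) | bc <- s]; rewrite big_map mulr_sumr.
by apply: eq_bigr => bc _; rewrite !mulrA.
Qed.

Lemma ideal2Mr a u : u \in ideal2 -> u * a \in ideal2.
Proof.
move=> /asboolP[s ->]; apply/asboolP.
exists [seq (bc.1, bc.2 * a) | bc <- s]; rewrite big_map mulr_suml.
by apply: eq_bigr => bc _; rewrite !mulrA.
Qed.

Lemma ideal2Z (c : k) u : u \in ideal2 -> c *: u \in ideal2.
Proof. by move=> /(ideal2Ml c%:A); rewrite -scalerAl mul1r. Qed.

Lemma ideal2_proper (B : nzRingType) (f : {rmorphism A -> B}) :
  f r = 0 -> 1 \notin ideal2.
Proof.
move=> fr; apply/negP => /asboolP[s /(congr1 f)].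
rewrite rmorph_sum rmorph1 big1 => [/eqP|ab _]; first by rewrite oner_eq0.
by rewrite !rmorphM fr mulr0 mul0r.
Qed.

(* The properness hypothesis is there because an [algType] is nontrivial. *)
Definition alg_quot (proper : 1 \notin ideal2) : Type := Quotient.quot ideal2_zmod.

Variable proper : 1 \notin ideal2.
Local Notation Q := (alg_quot proper).
HB.instance Definition _ := GRing.Zmodule.on Q.

Definition aq_pi (u : A) : Q := \pi_(Quotient.quot ideal2_zmod) u.
Definition aq_repr (a : Q) : A := repr (a : Quotient.quot ideal2_zmod).

Lemma aq_piE u v : aq_pi u = aq_pi v <-> u - v \in ideal2.
Proof. by rewrite Quotient.idealrBE; split=> [/eqP|/eqP]. Qed.

Lemma aq_reprK : cancel aq_repr aq_pi.
Proof. by move=> a; exact: reprK. Qed.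

Lemma aq_pi_repr u : aq_repr (aq_pi u) - u \in ideal2.
Proof. by apply/aq_piE; rewrite aq_reprK. Qed.

Lemma aq_pi0 : aq_pi 0 = 0.
Proof. exact: (raddf0 \pi_(Quotient.quot ideal2_zmod)). Qed.

Lemma aq_piD : {morph aq_pi : u v / u + v}.
Proof. exact: (raddfD \pi_(Quotient.quot ideal2_zmod)). Qed.

Definition aq_one : Q := aq_pi 1.
Definition aq_mul (a b : Q) : Q := aq_pi (aq_repr a * aq_repr b).
Definition aq_scale (c : k) (a : Q) : Q := aq_pi (c *: aq_repr a).

Lemma aq_piM u v : aq_mul (aq_pi u) (aq_pi v) = aq_pi (u * v).
Proof.
apply/aq_piE; rewrite -(subrK (u * aq_repr (aq_pi v)) (_ * _)) -mulrBl -addrA.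
rewrite -mulrBr rpredD //; first exact/ideal2Mr/aq_pi_repr.
exact/ideal2Ml/aq_pi_repr.
Qed.

Lemma aq_piZ c u : aq_scale c (aq_pi u) = aq_pi (c *: u).
Proof. by apply/aq_piE; rewrite -scalerBr; apply/ideal2Z/aq_pi_repr. Qed.

Lemma aq_ind (P : Q -> Prop) : (forall u, P (aq_pi u)) -> forall a, P a.
Proof. by move=> Ppi a; rewrite -(aq_reprK a). Qed.

Lemma aq_mulA : associative aq_mul.
Proof.
elim/aq_ind=> u; elim/aq_ind=> v; elim/aq_ind=> w.
by rewrite !aq_piM mulrA.
Qed.

Lemma aq_mul1 : left_id aq_one aq_mul.
Proof. by elim/aq_ind=> u; rewrite aq_piM mul1r. Qed.

Lemma aq_mulr1 : right_id aq_one aq_mul.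
Proof. by elim/aq_ind=> u; rewrite aq_piM mulr1. Qed.

Lemma aq_mulDl : left_distributive aq_mul +%R.
Proof.
elim/aq_ind=> u; elim/aq_ind=> v; elim/aq_ind=> w.
by rewrite -aq_piD !aq_piM mulrDl aq_piD.
Qed.

Lemma aq_mulDr : right_distributive aq_mul +%R.
Proof.
elim/aq_ind=> u; elim/aq_ind=> v; elim/aq_ind=> w.
by rewrite -aq_piD !aq_piM mulrDr aq_piD.
Qed.

Lemma aq_one_neq0 : aq_one != 0.
Proof.
apply/eqP; rewrite -aq_pi0 => /aq_piE.
by rewrite subr0; apply/negP.
Qed.

HB.instance Definition _ := GRing.Zmodule_isNzRing.Build Q
  aq_mulA aq_mul1 aq_mulr1 aq_mulDl aq_mulDr aq_one_neq0.

Lemma aq_scaleA a b v : aq_scale a (aq_scale b v) = aq_scale (a * b) v.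
Proof. by elim/aq_ind: v => u; rewrite !aq_piZ scalerA. Qed.

Lemma aq_scale1 : left_id 1 aq_scale.
Proof. by elim/aq_ind=> u; rewrite aq_piZ scale1r. Qed.

Lemma aq_scaleDr : right_distributive aq_scale +%R.
Proof.
move=> a; elim/aq_ind=> u; elim/aq_ind=> v.
by rewrite -aq_piD !aq_piZ scalerDr aq_piD.
Qed.

Lemma aq_scaleDl v : {morph aq_scale^~ v : a b / a + b}.
Proof. by elim/aq_ind: v => u a b; rewrite !aq_piZ scalerDl aq_piD. Qed.

HB.instance Definition _ := GRing.Zmodule_isLmodule.Build k Q
  aq_scaleA aq_scale1 aq_scaleDr aq_scaleDl.

Lemma aq_scaleAl (c : k) (a b : Q) : c *: (a * b) = (c *: a) * b.
Proof.
elim/aq_ind: a => u; elim/aq_ind: b => v.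
by rewrite /GRing.scale /GRing.mul /= !(aq_piM, aq_piZ) scalerAl.
Qed.

HB.instance Definition _ := GRing.Lmodule_isLalgebra.Build k Q aq_scaleAl.

Lemma aq_scaleAr (c : k) (a b : Q) : c *: (a * b) = a * (c *: b).
Proof.
elim/aq_ind: a => u; elim/aq_ind: b => v.
by rewrite /GRing.scale /GRing.mul /= !(aq_piM, aq_piZ) scalerAr.
Qed.

HB.instance Definition _ := GRing.Lalgebra_isAlgebra.Build k Q aq_scaleAr.

Lemma aq_pi_linear : linear aq_pi.
Proof. by move=> c u v; rewrite aq_piD -aq_piZ. Qed.

Lemma aq_pi_monoid_morphism : monoid_morphism aq_pi.
Proof. by split=> // u v; rewrite -aq_piM. Qed.

HB.instance Definition _ := GRing.isLinear.Build k A Q _ aq_pi aq_pi_linear.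
HB.instance Definition _ :=
  GRing.isMonoidMorphism.Build A Q aq_pi aq_pi_monoid_morphism.

End PrincipalQuotient.

Definition jordan_rel (A : nzRingType) (x y : A) : A := x * y - y * x - y ^+ 2.

Lemma rmorph_jordan_rel (A B : nzRingType) (f : {rmorphism A -> B}) x y :
  f (jordan_rel x y) = jordan_rel (f x) (f y).
Proof. by rewrite /jordan_rel !(rmorphB, rmorphXn, rmorphM). Qed.

Section FreeAlgebra.
Variable k : fieldType.

(* The free algebra k<X, Y>, as the algebra of the free monoid on two letters. *)
Definition free_alg : Type := {malg k[{fmonom 'I_2}]}.
HB.instance Definition _ := GRing.Lalgebra.on free_alg.

Lemma malg_scalerAr (c : k) (u v : {malg k[{fmonom 'I_2}]}) :
  c *: (u * v) = u * (c *: v).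
Proof.
have malgCC (g : {malg k[{fmonom 'I_2}]}) :
    mkmalgU mone c * g = g * mkmalgU mone c.
  rewrite malgM_def fgmulUg malgM_def fgmulgU.
  by apply: eq_bigr => w _; rewrite mul1m mulm1 mulrC.
by rewrite -!mul_malgC mulrA malgCC mulrA.
Qed.

HB.instance Definition _ :=
  GRing.Lalgebra_isAlgebra.Build k free_alg malg_scalerAr.

Definition freeX : free_alg := mkmalgU (fmu ord0) 1.
Definition freeY : free_alg := mkmalgU (fmu ord_max) 1.

Definition free_aug : free_alg -> k := mcoeff mone.

Lemma free_aug_zmod_morphism : zmod_morphism free_aug.
Proof. exact: (raddfB (mcoeff mone : {malg k[{fmonom 'I_2}]} -> k)). Qed.

Lemma free_aug_monoid_morphism : monoid_morphism free_aug.
Proof.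
split; first exact: (rmorph1 (mcoeff mone : {malg k[{fmonom 'I_2}]} -> k)).
exact: (rmorphM (mcoeff mone : {malg k[{fmonom 'I_2}]} -> k)).
Qed.

HB.instance Definition _ :=
  GRing.isZmodMorphism.Build free_alg k free_aug free_aug_zmod_morphism.
HB.instance Definition _ :=
  GRing.isMonoidMorphism.Build free_alg k free_aug free_aug_monoid_morphism.

Lemma free_augX : free_aug freeX = 0.
Proof. by rewrite /free_aug mcoeffU fm1_eq1. Qed.

Lemma free_augY : free_aug freeY = 0.
Proof. by rewrite /free_aug mcoeffU fm1_eq1. Qed.

Lemma jordan_rel_proper : 1 \notin ideal2 (jordan_rel freeX freeY).
Proof.
apply: (ideal2_proper (f := free_aug)); rewrite rmorph_jordan_rel /=.
by rewrite free_augX free_augY /jordan_rel mulr0 subrr expr0n subrr.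
Qed.

End FreeAlgebra.

(* k<x, y | xy - yx = y^2>. *)
Definition jordan_plane (k : fieldType) : algType k :=
  alg_quot (jordan_rel_proper k).
Definition jpX {k : fieldType} : jordan_plane k := aq_pi (jordan_rel_proper k) (freeX k).
Definition jpY {k : fieldType} : jordan_plane k := aq_pi (jordan_rel_proper k) (freeY k).

(* Product convention: (f * g) x = f (g x). *)
Section AlgAut.
Variables (k : fieldType) (A : algType k).

Record alg_aut : Type := AlgAut {
  aut_fun :> A -> A;
  aut_linear : linear aut_fun;
  aut_monoid_morphism : monoid_morphism aut_fun;
  aut_bij : bijective aut_fun
}.

HB.instance Definition _ (f : alg_aut) :=
  GRing.isLinear.Build k A A _ (aut_fun f) (aut_linear f).
HB.instance Definition _ (f : alg_aut) :=
  GRing.isMonoidMorphism.Build A A (aut_fun f) (aut_monoid_morphism f).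

Lemma aut_ext (f g : alg_aut) : f =1 g -> f = g.
Proof.
case: f g => [f lf mf bf] [g lg mg bg] /= /funext fg; case: _ / fg lg mg bg.
by move=> lg mg bg; congr AlgAut; exact: Prop_irrelevance.
Qed.

HB.instance Definition _ := gen_eqMixin alg_aut.
HB.instance Definition _ := gen_choiceMixin alg_aut.

Lemma idfun_linear : linear (idfun : A -> A). Proof. by []. Qed.
Lemma idfun_monoid_morphism : monoid_morphism (idfun : A -> A).
Proof. by []. Qed.

Definition aut_one : alg_aut :=
  AlgAut idfun_linear idfun_monoid_morphism
    (Bijective (fun=> erefl) (fun=> erefl)).

Section Comp.
Variables f g : alg_aut.

Lemma aut_comp_linear : linear (f \o g).
Proof. by move=> c u v; rewrite /= !linearP. Qed.

Lemma aut_comp_monoid_morphism : monoid_morphism (f \o g).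
Proof. by split=> [|u v]; rewrite /= ?rmorph1 ?rmorphM. Qed.

Definition aut_mul : alg_aut := AlgAut aut_comp_linear
  aut_comp_monoid_morphism (bij_comp (aut_bij f) (aut_bij g)).
End Comp.

Section Inverse.
Variable f : alg_aut.

Lemma aut_surj y : exists x, f x == y.
Proof. by case: (aut_bij f) => g _ gK; exists (g y); rewrite gK. Qed.

Definition aut_inv_fun (y : A) : A := xchoose (aut_surj y).

Lemma aut_invKV : cancel aut_inv_fun f.
Proof. by move=> y; apply/eqP/(xchooseP (aut_surj y)). Qed.

Lemma aut_invK : cancel f aut_inv_fun.
Proof. by move=> x; apply: (bij_inj (aut_bij f)); rewrite aut_invKV. Qed.

Lemma aut_inv_linear : linear aut_inv_fun.
Proof.
move=> c u v; apply: (bij_inj (aut_bij f)).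
by rewrite linearP /= !aut_invKV.
Qed.

Lemma aut_inv_monoid_morphism : monoid_morphism aut_inv_fun.
Proof.
split=> [|u v]; apply: (bij_inj (aut_bij f)).
  by rewrite rmorph1 aut_invKV.
by rewrite rmorphM /= !aut_invKV.
Qed.

Definition aut_inv : alg_aut := AlgAut aut_inv_linear aut_inv_monoid_morphism
  (Bijective aut_invKV aut_invK).
End Inverse.

Lemma aut_mulA : associative aut_mul.
Proof. by move=> f g h; apply: aut_ext. Qed.
Lemma aut_mul1 : left_id aut_one aut_mul.
Proof. by move=> f; apply: aut_ext. Qed.
Lemma aut_mulr1 : right_id aut_one aut_mul.
Proof. by move=> f; apply: aut_ext. Qed.
Lemma aut_mulV : left_inverse aut_one aut_inv aut_mul.
Proof. by move=> f; apply: aut_ext => x; exact: aut_invK. Qed.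
Lemma aut_mulrV : right_inverse aut_one aut_inv aut_mul.
Proof. by move=> f; apply: aut_ext => x; exact: aut_invKV. Qed.

HB.instance Definition _ := isGroup.Build alg_aut
  aut_mulA aut_mul1 aut_mulr1 aut_mulV aut_mulrV.
End AlgAut.

Section MulGroup.
Variable k : fieldType.

Definition mulgroup : Type := {a : k | a != 0}.
HB.instance Definition _ := Choice.on mulgroup.

Implicit Types a b c : mulgroup.

Definition mg_one : mulgroup := exist _ 1 (oner_neq0 k).
Definition mg_mul a b : mulgroup :=
  exist _ (val a * val b) (mulf_neq0 (valP a) (valP b)).
Definition mg_inv a : mulgroup := exist _ (val a)^-1 (invr_neq0 (valP a)).

Lemma mg_mulA : associative mg_mul.
Proof. by move=> a b c; apply: val_inj; rewrite /= mulrA. Qed.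
Lemma mg_mul1 : left_id mg_one mg_mul.
Proof. by move=> a; apply: val_inj; rewrite /= mul1r. Qed.
Lemma mg_mulr1 : right_id mg_one mg_mul.
Proof. by move=> a; apply: val_inj; rewrite /= mulr1. Qed.
Lemma mg_mulV : left_inverse mg_one mg_inv mg_mul.
Proof. by move=> a; apply: val_inj; rewrite /= mulVf ?(valP a). Qed.
Lemma mg_mulrV : right_inverse mg_one mg_inv mg_mul.
Proof. by move=> a; apply: val_inj; rewrite /= mulfV ?(valP a). Qed.

HB.instance Definition _ := isGroup.Build mulgroup
  mg_mulA mg_mul1 mg_mulr1 mg_mulV mg_mulrV.
End MulGroup.

(* An action of H on the additive group N by group automorphisms; each
   [act_fun h] is bijective, with inverse [act_fun h^-1]. *)
Record add_action (H : groupType) (N : zmodType) := AddAction {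
  act_fun :> H -> N -> N;
  act_add : forall h, {morph act_fun h : m n / m + n};
  act_one : forall n, act_fun 1%g n = n;
  act_mul : forall g h n, act_fun (g * h)%g n = act_fun g (act_fun h n)
}.

(* External semidirect product: (m, g) * (n, h) = (m + phi g n, g * h). *)
Section SemiDirect.
Variables (H : groupType) (N : zmodType) (phi : add_action H N).

Definition semidirect of add_action H N : Type := (N * H)%type.
Local Notation S := (semidirect phi).
HB.instance Definition _ := Choice.on S.

Implicit Types u v w : S.

Definition sd_one : S := (0, 1%g).
Definition sd_mul u v : S := (u.1 + phi u.2 v.1, (u.2 * v.2)%g).
Definition sd_inv u : S := (phi u.2^-1%g (- u.1), u.2^-1%g).

Lemma act0 h : phi h 0 = 0.
Proof. by apply: (addrI (phi h 0)); rewrite -act_add !addr0. Qed.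

Lemma sd_mulA : associative sd_mul.
Proof.
by move=> u v w; rewrite /sd_mul /= act_add act_mul addrA mulgA.
Qed.
Lemma sd_mul1 : left_id sd_one sd_mul.
Proof. by case=> n h; rewrite /sd_mul /= act_one add0r mul1g. Qed.
Lemma sd_mulr1 : right_id sd_one sd_mul.
Proof. by case=> n h; rewrite /sd_mul /= act0 addr0 mulg1. Qed.
Lemma sd_mulV : left_inverse sd_one sd_inv sd_mul.
Proof.
by case=> n h; rewrite /sd_mul /= -act_add addNr act0 mulVg.
Qed.
Lemma sd_mulrV : right_inverse sd_one sd_inv sd_mul.
Proof.
by case=> n h; rewrite /sd_mul /= -act_mul mulgV act_one subrr.
Qed.

HB.instance Definition _ := isGroup.Build S
  sd_mulA sd_mul1 sd_mulr1 sd_mulV sd_mulrV.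
End SemiDirect.

(* Main.v *)
Require Import Defs.
From HB Require Import structures.
From mathcomp Require Import all_boot all_algebra.
From mathcomp Require Import monalg boolp functions ring zify.

Set Implicit Arguments.
Unset Strict Implicit.
Unset Printing Implicit Defensive.

Import GRing.Theory.
Local Open Scope ring_scope.

(** Every element of R = k<x, y | xy - yx = y^2> is uniquely a sum of terms
    p_j(y) x^j, since R is the Ore extension k[y][x; delta] with
    delta = y^2 d/dy.  Spanning is the rewriting x c(y) = c(y) x + delta(c)(y).
    Independence comes from letting R act on k[y][X], with y acting as
    multiplication by y and x acting as P |-> P X + delta(P), where delta is
    applied to coefficients: the action of p_0(y) + p_1(y) x + ... on 1 returns
    the polynomial p_0 + p_1 X + ... itself ([nfK], [evK]).  In these coordinates
    the product of R is
        P * Q = sum_i (1/i!) (d/dX)^i P . delta^i Q        ([nf_rep_ev]).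
    The term i = 0 dominates in the degree in X.  Hence degrees in x add up, and
    the only units of R are the scalars ([presented_unit]).  The term
    i = 1 of P * y is y^2 dP/dX, which in characteristic 0 vanishes only for P in
    k[y]; so only k[y] commutes with y ([presented_centralizer]).

    Let f be an automorphism.  The algebra R / yR = k[X] is commutative and
    reduced, and f(y)^2 is the commutator of f(x) and f(y); so f(y) is in yR
    ([endo_y]).  The same holds for the inverse of f.  If f(y) = y u and
    f^-1(y) = y v, then y = f(y v) = y u f(v), so u f(v) = 1 and u is a scalar
    alpha: f(y) = alpha y.  Applying f to the relation gives
    [f(x), y] = alpha y^2 = [alpha x, y], so f(x) - alpha x commutes with y and
    is a polynomial in y ([aut_form]).

    Conversely alpha x + p(y) and alpha y satisfy the relation, and the
    endomorphism they define has an inverse of the same form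
    ([jordan_aut_exists]).  Since (p, alpha) is the product of (p, 1) and
    (0, alpha), the isomorphism from the semidirect product must send it to
    x |-> alpha (x + p(y)), y |-> alpha y, and conjugating by (0, alpha) forces
    the action p(y) |-> alpha^-1 p(alpha y).

    The arguments are carried out for an arbitrary algebra with the generation
    and lifting properties of the presentation ([jordan_presented]), so that
    nothing depends on how the quotient of the free algebra is built. *)

(** * The algebra of endomorphisms of a vector space *)

Section EndAlgebra.
(* The element 1 != 0 of the algebra V keeps its endomorphisms from forming the
   zero ring. *)
Variables (k : fieldType) (V : lalgType k).

Definition linear_op : {pred V -> V} := fun f => `[< linear f >].

Lemma linear_op_submod_closed : submod_closed linear_op.
Proof.
split=> [|c f g /asboolP lf /asboolP lg]; apply/asboolP => d u v.
  by rewrite scaler0 add0r.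
have scE w : (c *: f + g) w = c *: f w + g w by [].
rewrite !scE lf lg !scalerDr !scalerA mulrC -!addrA.
by congr (_ + _); rewrite addrCA.
Qed.

HB.instance Definition _ :=
  GRing.isSubmodClosed.Build k (V -> V) linear_op linear_op_submod_closed.

Record lin_end := LinEnd {
  lin_end_fun :> V -> V;
  _ : lin_end_fun \in linear_op
}.

HB.instance Definition _ := [isSub for lin_end_fun].
HB.instance Definition _ := [Choice of lin_end by <:].
HB.instance Definition _ := [SubChoice_isSubLmodule of lin_end by <:].

Implicit Types f g h : lin_end.

Lemma lin_end_linear f : linear f.
Proof. by apply/asboolP; case: f. Qed.
HB.instance Definition _ f :=
  GRing.isLinear.Build k V V _ (lin_end_fun f) (lin_end_linear f).

Lemma lin_endP f g : f =1 g -> f = g.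
Proof. by move=> fg; apply: val_inj; apply/funext. Qed.

Definition lin_end_of (f : {linear V -> V}) : lin_end :=
  LinEnd (introT (asboolP _) (linearP f)).

Definition lin_end_one := lin_end_of idfun.
Definition lin_end_mul f g := lin_end_of (f \o g).

Fact lin_end_mulA : associative lin_end_mul.
Proof. by move=> f g h; apply: lin_endP. Qed.
Fact lin_end_mul1 : left_id lin_end_one lin_end_mul.
Proof. by move=> f; apply: lin_endP. Qed.
Fact lin_end_mulr1 : right_id lin_end_one lin_end_mul.
Proof. by move=> f; apply: lin_endP. Qed.
Fact lin_end_mulDl : left_distributive lin_end_mul +%R.
Proof. by move=> f g h; apply: lin_endP. Qed.
Fact lin_end_mulDr : right_distributive lin_end_mul +%R.
Proof. by move=> f g h; apply: lin_endP => v; rewrite /= raddfD. Qed.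
Fact lin_end_one_neq0 : lin_end_one != 0.
Proof.
by apply/eqP=> /(congr1 (fun f : lin_end => f 1))/eqP; rewrite oner_eq0.
Qed.

HB.instance Definition _ := GRing.Zmodule_isNzRing.Build lin_end
  lin_end_mulA lin_end_mul1 lin_end_mulr1 lin_end_mulDl lin_end_mulDr
  lin_end_one_neq0.

Fact lin_end_scaleAl (c : k) f g : c *: (f * g) = (c *: f) * g.
Proof. by apply: lin_endP. Qed.
HB.instance Definition _ :=
  GRing.Lmodule_isLalgebra.Build k lin_end lin_end_scaleAl.
Fact lin_end_scaleAr (c : k) f g : c *: (f * g) = f * (c *: g).
Proof. by apply: lin_endP => v; apply: esym; exact: (linearZ_LR f). Qed.
HB.instance Definition _ :=
  GRing.Lalgebra_isAlgebra.Build k lin_end lin_end_scaleAr.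

End EndAlgebra.

(** * The universal property of the presentation *)

Section Lift.
Variables (k : fieldType) (A : algType k) (a b : A).

Definition word_prod (w : {fmonom 'I_2}) : A :=
  \prod_(i <- w : seq 'I_2) (if i == ord0 then a else b).

Lemma word_prod_mmorphism : mmorphism word_prod.
Proof.
split=> [u v|]; rewrite /word_prod; first by rewrite fmM big_cat.
by rewrite fm1 big_nil.
Qed.
HB.instance Definition _ :=
  monalg.isMultiplicative.Build {fmonom 'I_2} A word_prod word_prod_mmorphism.

Definition free_lift (u : free_alg k) : A := mmap (in_alg A) word_prod u.

Lemma free_lift_linear : linear free_lift.
Proof.
move=> c u v; rewrite /free_lift mmapD; congr (_ + _).
by rewrite (mmapZ (f := in_alg A)) /= mulr_algl.
Qed.

Lemma free_lift_monoid_morphism : monoid_morphism free_lift.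
Proof.
have [|mM m1] := @commr_mmap_is_multiplicative _ _ _ (in_alg A) word_prod.
  by move=> g w w'; rewrite /GRing.comm /= mulr_algl mulr_algr.
by split.
Qed.

HB.instance Definition _ :=
  GRing.isLinear.Build k (free_alg k) A _ free_lift free_lift_linear.
HB.instance Definition _ := GRing.isMonoidMorphism.Build (free_alg k) A
  free_lift free_lift_monoid_morphism.

Lemma free_liftX : free_lift (freeX k) = a.
Proof.
by rewrite /free_lift mmapU /= scale1r mul1r /word_prod fmU big_seq1.
Qed.

Lemma free_liftY : free_lift (freeY k) = b.
Proof.
by rewrite /free_lift mmapU /= scale1r mul1r /word_prod fmU big_seq1.
Qed.

Hypothesis rel_ab : jordan_rel a b = 0.

(** The proof of the relation is an argument so that the linear and ring
    morphism structures can be attached to [jp_lift] itself. *)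
Definition jp_lift of jordan_rel a b = 0 : jordan_plane k -> A :=
  fun r => free_lift (aq_repr r).
Local Notation lift := (jp_lift rel_ab).

(** Two representatives of a class differ by an element of the ideal of the
    relation, on which [free_lift] vanishes. *)
Lemma jp_lift_pi u : lift (aq_pi (jordan_rel_proper k) u) = free_lift u.
Proof.
have /asboolP[s /(congr1 free_lift)] := aq_pi_repr (jordan_rel_proper k) u.
rewrite raddf_sum big1 => [/eqP|cd _]; first by rewrite raddfB subr_eq0 => /eqP.
rewrite /= !rmorphM rmorph_jordan_rel /= free_liftX free_liftY rel_ab.
by rewrite mulr0 mul0r.
Qed.

Lemma jp_lift_linear : linear lift.
Proof.
move=> c; elim/aq_ind=> u; elim/aq_ind=> v.
by rewrite -linearP !jp_lift_pi linearP.
Qed.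

Lemma jp_lift_monoid_morphism : monoid_morphism lift.
Proof.
split; first by rewrite -(rmorph1 (aq_pi _)) jp_lift_pi rmorph1.
elim/aq_ind=> u; elim/aq_ind=> v.
by rewrite -rmorphM !jp_lift_pi rmorphM.
Qed.

HB.instance Definition _ :=
  GRing.isLinear.Build k (jordan_plane k) A _ lift jp_lift_linear.
HB.instance Definition _ := GRing.isMonoidMorphism.Build (jordan_plane k) A
  lift jp_lift_monoid_morphism.

Lemma jp_liftX : lift jpX = a.
Proof. by rewrite jp_lift_pi free_liftX. Qed.

Lemma jp_liftY : lift jpY = b.
Proof. by rewrite jp_lift_pi free_liftY. Qed.

End Lift.

(** What the presentation says of R, x and y: the relation, the fact that x and
    y generate R, and the lifting of solutions of the relation.  Generation is
    an induction principle along left multiplication by x and y, the form in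
    which it is used. *)
Record jordan_presented (k : fieldType) (R : algType k) (x y : R) : Prop :=
JordanPresented {
  presented_rel : x * y = y * x + y ^+ 2;
  presented_ind (P : R -> Prop) :
    P 1 -> (forall c u v, P u -> P v -> P (c *: u + v)) ->
    (forall u, P u -> P (x * u)) -> (forall u, P u -> P (y * u)) ->
    forall u, P u;
  presented_lift (A : algType k) (a b : A) : jordan_rel a b = 0 ->
    exists f : {lrmorphism R -> A}, f x = a /\ f y = b
}.

Section Generation.
Variable k : fieldType.
Local Notation R := (jordan_plane k).

Lemma jp_relE : jpX * jpY = jpY * jpX + jpY ^+ 2 :> R.
Proof.
apply/eqP; rewrite -subr_eq0 opprD addrA.
rewrite -/(jordan_rel _ _) -rmorph_jordan_rel; apply/eqP.
rewrite -[RHS](aq_pi0 (jordan_rel_proper k)); apply/aq_piE; rewrite subr0.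
by apply/asboolP; exists [:: (1, 1)]; rewrite big_seq1 mul1r mulr1.
Qed.

Lemma jp_ind (P : R -> Prop) :
    P 1 -> (forall c u v, P u -> P v -> P (c *: u + v)) ->
    (forall u, P u -> P (jpX * u)) -> (forall u, P u -> P (jpY * u)) ->
  forall u, P u.
Proof.
move=> P1 Plin PX PY.
have P0 : P 0 by rewrite -(addNr (1 : R)) -scaleN1r; apply: Plin.
have Padd u v : P u -> P v -> P (u + v) by rewrite -{2}[u]scale1r; apply: Plin.
have Pword (s : seq 'I_2) :
    P (aq_pi (jordan_rel_proper k) (mkmalgU (FMonom s) 1)).
  elim: s => [|i s IHs].
    by rewrite -fmoneE -/mone.
  have -> : mkmalgU (FMonom (i :: s)) 1
    = (mkmalgU (fmu i) 1 * mkmalgU (FMonom s) 1 : free_alg k).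
    by rewrite [RHS]malgM_def fgmulUU mulr1 /mmul /= fmmulE fmuE.
  rewrite rmorphM; have [->|->]: i = ord0 \/ i = ord_max.
  - by case: i => [[|[|]] // lti]; [left | right]; apply: val_inj.
  - exact: PX.
  - exact: PY.
elim/aq_ind=> u; rewrite [u]monalgE.
elim/big_ind: _ => [|v w Pv Pw|w _]; first by rewrite raddf0.
  by rewrite raddfD; apply: Padd.
rewrite -[w]fmK -[X in P X]addr0.
have -> : << u@_(FMonom w) *g FMonom w >> =
  u@_(FMonom w) *: (mkmalgU (FMonom w) 1 : free_alg k).
  by apply/malgP => m; rewrite mcoeffZ !mcoeffU mulrnAr mulr1.
by rewrite linearZ; apply: Plin => //; exact: Pword.
Qed.

Lemma jordan_plane_presented : jordan_presented (@jpX k) jpY.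
Proof.
split=> [|P|A a b ab]; [exact: jp_relE | exact: jp_ind |].
by exists (jp_lift ab); split; [exact: jp_liftX | exact: jp_liftY].
Qed.
End Generation.

(** * Ordered polynomials in two noncommuting elements *)

Section OrderedEval.
Variables (k : fieldType) (A : algType k).
Implicit Types (a b : A) (P : {poly {poly k}}).

(** The sum of the P_j(b) a^j: evaluation with all powers of b on the left. *)
Definition ordered_eval a b P : A := (map_poly (horner_alg b) P).[a].

Lemma ordered_evalD a b : {morph ordered_eval a b : P Q / P + Q}.
Proof. by move=> P Q; rewrite /ordered_eval rmorphD hornerD. Qed.

Lemma ordered_evalC a b c : ordered_eval a b c%:P = horner_alg b c.
Proof. by rewrite /ordered_eval map_polyC hornerC. Qed.

Lemma ordered_evalMX a b P : ordered_eval a b (P * 'X) = ordered_eval a b P * a.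
Proof. by rewrite /ordered_eval rmorphM /= map_polyX hornerMX. Qed.

Lemma ordered_evalZ a b c P :
  ordered_eval a b (c *: P) = horner_alg b c * ordered_eval a b P.
Proof. by rewrite /ordered_eval map_polyZ hornerZ. Qed.

End OrderedEval.

Lemma comm_horner_alg (k : fieldType) (A : algType k) (b : A) (p : {poly k}) :
  horner_alg b p * b = b * horner_alg b p.
Proof.
by rewrite -[X in _ * X](horner_algX b) -rmorphM mulrC rmorphM /= horner_algX.
Qed.

Lemma horner_algZ (k : fieldType) (A : algType k) (b : A) (c : k)
    (p : {poly k}) :
  horner_alg b (c *: p) = c *: horner_alg b p.
Proof. by rewrite linearZ /= mulr_algl. Qed.

Lemma horner_alg_scale (k : fieldType) (A : algType k) (b : A) (c : k)
    (p : {poly k}) :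
  horner_alg (c *: b) p = horner_alg b (p \Po (c *: 'X)).
Proof.
elim/poly_ind: p => [|p d IHp]; first by rewrite comp_poly0 !raddf0.
rewrite comp_polyD comp_polyM comp_polyX comp_polyC !(rmorphD, rmorphM) /= IHp.
by rewrite !horner_algC horner_algX horner_algZ horner_algX.
Qed.

Lemma rmorph_horner_alg (k : fieldType) (A B : algType k)
    (f : {lrmorphism A -> B}) b (c : {poly k}) :
  f (horner_alg b c) = horner_alg (f b) c.
Proof.
elim/poly_ind: c => [|c d IHc]; first by rewrite !raddf0.
rewrite !(rmorphD, rmorphM) /= !horner_algC !horner_algX IHc.
by rewrite linearZ_LR rmorph1.
Qed.

(** * The action on k[y][X] *)

(** The derivation y^2 d/dy, which is the commutator with x on k[y]. *)
Definition jderiv (k : fieldType) (c : {poly k}) : {poly k} := 'X^2 * c^`().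

Lemma jderiv_linear (k : fieldType) : linear (@jderiv k).
Proof. by move=> c p q; rewrite /jderiv linearP /= mulrDr scalerAr. Qed.
HB.instance Definition _ (k : fieldType) :=
  GRing.isLinear.Build k {poly k} {poly k} _ (@jderiv k) (@jderiv_linear k).

Lemma jderivMX (k : fieldType) (c : {poly k}) :
  jderiv (c * 'X) = jderiv c * 'X + c * 'X^2.
Proof. by rewrite /jderiv derivM derivX mulr1 mulrDr mulrA [c * _]mulrC. Qed.

Section NormalForm.
Variable k : fieldType.

(** k[y][X] as an algebra over k: the alias carries the scaling by constants of
    k, next to the scaling by k[y] of the underlying polynomial type. *)
Definition normal_form : Type := {poly {poly k}}.
HB.instance Definition _ := GRing.NzRing.on normal_form.

Definition nf_scale (c : k) (P : normal_form) : normal_form :=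
  c%:P *: (P : {poly {poly k}}).

Fact nf_scaleA c d P : nf_scale c (nf_scale d P) = nf_scale (c * d) P.
Proof. by rewrite /nf_scale scalerA polyCM. Qed.
Fact nf_scale1 : left_id 1 nf_scale.
Proof. by move=> P; rewrite /nf_scale scale1r. Qed.
Fact nf_scaleDr : right_distributive nf_scale +%R.
Proof. by move=> c P Q; rewrite /nf_scale scalerDr. Qed.
Fact nf_scaleDl P : {morph nf_scale^~ P : c d / c + d}.
Proof. by move=> c d; rewrite /nf_scale polyCD scalerDl. Qed.
HB.instance Definition _ := GRing.Zmodule_isLmodule.Build k normal_form
  nf_scaleA nf_scale1 nf_scaleDr nf_scaleDl.
Fact nf_scaleAl (c : k) (P Q : normal_form) : c *: (P * Q) = (c *: P) * Q.
Proof. exact: (scalerAl (c%:P) (P : {poly {poly k}}) Q). Qed.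
HB.instance Definition _ :=
  GRing.Lmodule_isLalgebra.Build k normal_form nf_scaleAl.

Lemma nf_scaleE (c : k) (P : normal_form) :
  c *: P = c%:P *: (P : {poly {poly k}}) :> {poly {poly k}}.
Proof. by []. Qed.

Definition coef_jderiv (P : {poly {poly k}}) : {poly {poly k}} :=
  map_poly (@jderiv k) P.

Lemma coef_jderivD : {morph coef_jderiv : P Q / P + Q}.
Proof. exact: raddfD. Qed.

Lemma nth_coef_jderiv P i : (coef_jderiv P)`_i = jderiv P`_i.
Proof. by rewrite coef_map. Qed.

Lemma coef_jderivC c : coef_jderiv c%:P = (jderiv c)%:P.
Proof. exact: map_polyC. Qed.

Lemma coef_jderivMX P : coef_jderiv (P * 'X) = coef_jderiv P * 'X.
Proof.
apply/polyP=> i; rewrite nth_coef_jderiv !coefMX nth_coef_jderiv.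
by case: eqP => // _; rewrite raddf0.
Qed.

Lemma size_coef_jderiv P : (size (coef_jderiv P) <= size P)%N.
Proof. exact: size_poly. Qed.

Lemma size_iter_coef_jderiv i P : (size (iter i coef_jderiv P) <= size P)%N.
Proof. by elim: i => //= i; apply: leq_trans; exact: size_coef_jderiv. Qed.

(** Left multiplications by x and y, read on the coordinates P of the element
    with ordered expression P: x p(y) x^j = p(y) x^(j+1) + delta(p)(y) x^j. *)
Definition opX (P : normal_form) : normal_form :=
  (P : {poly {poly k}}) * 'X + coef_jderiv P.
Definition opY (P : normal_form) : normal_form := 'X *: (P : {poly {poly k}}).

Lemma opX_linear : linear opX.
Proof.
move=> c P Q; rewrite /opX !nf_scaleE coef_jderivD mulrDl scalerDr -scalerAl.
rewrite !addrA.
congr (_ + _); rewrite -!addrA; congr (_ + _); rewrite addrC; congr (_ + _).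
apply/polyP=> i; rewrite nth_coef_jderiv !coefZ nth_coef_jderiv.
by rewrite !mul_polyC linearZ.
Qed.

Lemma opY_linear : linear opY.
Proof.
move=> c P Q; rewrite /opY !nf_scaleE scalerDr !scalerA.
by rewrite ['X * _]mulrC.
Qed.

HB.instance Definition _ :=
  GRing.isLinear.Build k normal_form normal_form _ opX opX_linear.
HB.instance Definition _ :=
  GRing.isLinear.Build k normal_form normal_form _ opY opY_linear.

Lemma opXY_rel : jordan_rel (lin_end_of opX) (lin_end_of opY) = 0.
Proof.
apply/lin_endP=> P.
have -> : jordan_rel (lin_end_of opX) (lin_end_of opY) P
  = opX (opY P) - opY (opX P) - opY (opY P) by [].
apply/polyP=> i; rewrite /opX /opY.
rewrite !(coefB, coefD, coefZ, coef0, coefMX, nth_coef_jderiv).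
rewrite ['X * P`_i]mulrC jderivMX; case: (i == 0); rewrite ?(mulr0, add0r).
  ring.
by ring.
Qed.

(** The product of the algebra on coordinates.  [P^`N(i)] is the divided power
    (1/i!) (d/dX)^i P; the formula comes from the Leibniz expansion of the
    powers of the sum of the commuting operators [P |-> P * 'X] and
    [coef_jderiv]. *)
Definition star (P Q : {poly {poly k}}) : {poly {poly k}} :=
  \sum_(i < size P) P^`N(i) * iter i coef_jderiv Q.

Lemma star_widen (P Q : {poly {poly k}}) n : (size P <= n)%N ->
  star P Q = \sum_(i < n) P^`N(i) * iter i coef_jderiv Q.
Proof.
move=> lePn; rewrite /star.
rewrite (big_ord_widen _ (fun i => P^`N(i) * iter i coef_jderiv Q) lePn).
rewrite [RHS](bigID (fun i : 'I_n => (i < size P)%N)) /=.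
rewrite [X in _ + X]big1 ?addr0 // => i; rewrite -leqNgt => /nderivn_poly0->.
by rewrite mul0r.
Qed.

(** Only the term i = 0 of the product reaches the top degree: each further term
    lowers the degree of P, while [coef_jderiv] does not raise that of Q. *)
Lemma size_star (P Q : {poly {poly k}}) : P != 0 -> Q != 0 ->
  size (star P Q) = (size P + size Q).-1.
Proof.
move=> nzP nzQ; have := nzP; rewrite -size_poly_gt0 /star => szP.
case szPE: (size P) szP => [//|n] _; rewrite big_ord_recl nderivn0 /=.
have szPQ : size (P * Q) = (n.+1 + size Q).-1 by rewrite size_mul // szPE.
rewrite size_polyDl // szPQ.
apply: (@leq_ltn_trans (n + size Q).-1); last first.
  by have := nzQ; rewrite -size_poly_gt0; lia.
apply: (leq_trans (size_sum _ _ _)); apply/bigmax_leqP => i _.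
apply: (leq_trans (size_polyMleq _ _)).
have : (size P^`N(bump 0 i) <= n - i)%N.
  by apply: leq_trans (size_poly _ _) _; rewrite szPE /bump /=; lia.
move=> szN; rewrite -!subn1 leq_sub2r // leq_add //.
  exact: leq_trans szN (leq_subr _ _).
exact: (size_iter_coef_jderiv (bump 0 i) Q).
Qed.

Lemma iter_coef_jderivC i (c : {poly k}) :
  iter i coef_jderiv c%:P = (iter i (@jderiv k) c)%:P.
Proof. by elim: i => //= i ->; rewrite coef_jderivC. Qed.

Section Relation.
Variables (A : algType k) (a b : A).
Hypothesis ab : a * b = b * a + b ^+ 2.

Lemma mul_horner_alg_jderiv c :
  a * horner_alg b c = horner_alg b c * a + horner_alg b (jderiv c).
Proof.
elim/poly_ind: c => [|c d IHc]; first by rewrite !(raddf0, mulr0, mul0r, addr0).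
rewrite [jderiv _]raddfD /= jderivMX.
have -> : jderiv d%:P = 0 by rewrite /jderiv derivC mulr0.
(* [jderiv c] is generalized, lest it be unfolded as a product by [rmorphM] *)
rewrite addr0; move: (jderiv c) IHc => w IHc.
rewrite !(rmorphD, rmorphM, rmorphXn) /= horner_algX horner_algC.
rewrite mulrDr [a * (_ * _)]mulrA IHc !mulrDl -[_ * a * b]mulrA ab.
rewrite mulrDr -[_ * b * a]mulrA mulr_algl mulr_algr -!addrA.
by congr (_ + _); rewrite addrC [X in X + _]addrC -addrA expr2.
Qed.

Lemma ordered_eval_opX P :
  ordered_eval a b (opX P) = a * ordered_eval a b P.
Proof.
elim/poly_ind: P => [|P c IHP].
  by rewrite /opX mul0r add0r -polyC0 coef_jderivC !ordered_evalC !raddf0 mulr0.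
have -> : opX (P * 'X + c%:P)
  = opX P * 'X + c%:P * 'X + (jderiv c)%:P :> {poly _}.
  rewrite /opX coef_jderivD coef_jderivC coef_jderivMX !mulrDl -!addrA.
  by congr (_ + _); rewrite addrCA.
rewrite !ordered_evalD !ordered_evalMX IHP !ordered_evalC mulrDr.
by rewrite mul_horner_alg_jderiv mulrA addrA.
Qed.

Lemma ordered_eval_opY P :
  ordered_eval a b (opY P) = b * ordered_eval a b P.
Proof. by rewrite ordered_evalZ horner_algX. Qed.
End Relation.

(** * Normal forms, units and the centralizer of y *)

Section Presented.
Variables (R : algType k) (x y : R).
Hypothesis presR : jordan_presented x y.
Local Notation ev := (ordered_eval x y).

Definition nf_rep : {lrmorphism R -> lin_end normal_form} :=
  sval (cid (presented_lift presR opXY_rel)).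

Lemma nf_repX P : nf_rep x P = opX P.
Proof. by rewrite /nf_rep; case: cid => f [/= -> _]. Qed.
Lemma nf_repY P : nf_rep y P = opY P.
Proof. by rewrite /nf_rep; case: cid => f [/= _ ->]. Qed.
Lemma nf_repM r s P : nf_rep (r * s) P = nf_rep r (nf_rep s P).
Proof. by rewrite rmorphM. Qed.
Lemma nf_repD r s P : nf_rep (r + s) P = nf_rep r P + nf_rep s P.
Proof. by rewrite rmorphD. Qed.
Lemma nf_repZ c r P : nf_rep (c *: r) P = c *: nf_rep r P.
Proof. by rewrite linearZ. Qed.
Lemma nf_repZD c r s P : nf_rep (c *: r + s) P = c *: nf_rep r P + nf_rep s P.
Proof. by rewrite linearP. Qed.

(** Left multiplication by x or y corresponds to [opX] or [opY], and x, y
    generate R. *)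
Lemma ev_rep r P : ev (nf_rep r P) = r * ev P.
Proof.
elim/(presented_ind presR): r P => [|c r s IHr IHs|r IHr|r IHr] P.
- by rewrite rmorph1 mul1r.
- rewrite nf_repZD ordered_evalD IHs mulrDl; congr (_ + _).
  by rewrite nf_scaleE ordered_evalZ IHr horner_algC -!scalerAl mul1r.
- by rewrite nf_repM nf_repX (ordered_eval_opX (presented_rel presR)) IHr mulrA.
- by rewrite nf_repM nf_repY ordered_eval_opY IHr mulrA.
Qed.

Definition nf (r : R) : {poly {poly k}} := nf_rep r 1.

Lemma nfK : cancel nf ev.
Proof.
by move=> r; rewrite /nf ev_rep -polyC1 ordered_evalC rmorph1 mulr1.
Qed.

Lemma nf_rep_horner c Q :
  nf_rep (horner_alg y c) Q = c *: (Q : {poly {poly k}}).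
Proof.
elim/poly_ind: c Q => [|c d IHc] Q; first by rewrite !raddf0 scale0r.
rewrite rmorphD rmorphM /= horner_algX horner_algC nf_repD nf_repM nf_repY IHc.
by rewrite nf_repZ rmorph1 nf_scaleE scalerDl scalerA.
Qed.

(** By induction on P: the step from P to P X + c inserts one [opX] before the
    action of P, and matches the rule [nderivnMXaddC] for the divided
    derivatives of P X + c. *)
Lemma nf_rep_ev P Q : nf_rep (ev P) Q = star P Q.
Proof.
elim/poly_ind: P Q => [|P c IHP] Q.
  by rewrite -polyC0 ordered_evalC !raddf0 /star size_poly0 big_ord0.
rewrite ordered_evalD ordered_evalMX ordered_evalC nf_repD nf_repM nf_repX.
rewrite nf_rep_horner IHP.
have szP : (size (P * 'X + c%:P)%R <= (size P).+1)%N.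
  by rewrite size_MXaddC; case: ifP.
rewrite (star_widen _ szP) (star_widen _ (leqnSn _)).
have iterX i : iter i coef_jderiv (opX Q)
  = iter i coef_jderiv Q * 'X + iter i.+1 coef_jderiv Q.
  by elim: i => //= i ->; rewrite coef_jderivD coef_jderivMX.
under [in LHS]eq_bigr => i _ do rewrite iterX mulrDr.
rewrite big_split /= big_ord_recl big_ord_recr /= (nderivn_poly0 (leqnn _)).
rewrite mul0r addr0 [RHS]big_ord_recl !nderivn0 /=.
under [in RHS]eq_bigr => i _ do rewrite nderivnMXaddC mulrDl -mulrA.
rewrite big_split /= mulrDl mul_polyC mulrA [P * Q * 'X]mulrAC -!addrA.
congr (_ + _); rewrite addrA addrC; congr (_ + _); rewrite addrC; congr (_ + _).
by apply: eq_bigr => i _; rewrite ['X * _]mulrC.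
Qed.

(** The action on 1 leaves only the term i = 0, as delta kills constants. *)
Lemma evK : cancel ev nf.
Proof.
move=> P; rewrite /nf nf_rep_ev.
rewrite (star_widen _ (leqnSn _)) big_ord_recl nderivn0 mulr1.
rewrite big1 ?addr0 // => i _.
rewrite -[1]polyC1 iter_coef_jderivC iterSr.
have -> : jderiv (1 : {poly k}) = 0.
  by rewrite /jderiv -[1]polyC1 derivC mulr0.
have -> : iter i (@jderiv k) 0 = 0.
  by elim: (nat_of_ord i) => //= j ->; rewrite raddf0.
by rewrite mulr0.
Qed.

Lemma nf_mul r s : nf (r * s) = star (nf r) (nf s).
Proof. by rewrite /nf nf_repM -/(nf s) -{1}[r]nfK nf_rep_ev. Qed.

Lemma nf_y : nf y = 'X%:P.
Proof. by rewrite -(evK 'X%:P) ordered_evalC horner_algX. Qed.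

Lemma nf_yM r : nf (y * r) = 'X *: nf r.
Proof. by rewrite /nf nf_repM nf_repY. Qed.

Lemma y_lreg : GRing.lreg y.
Proof.
move=> r s /(congr1 nf); rewrite !nf_yM -!mul_polyC => /mulfI.
by rewrite polyC_eq0 polyX_eq0 => /(_ isT) /(can_inj nfK).
Qed.

Lemma presented_y_neq0 : y != 0.
Proof.
apply/eqP=> y0; have /y_lreg/eqP : y * 1 = y * 0 by rewrite y0 !mul0r.
by rewrite oner_eq0.
Qed.

Lemma horner_alg_inj : injective (horner_alg y : {poly k} -> R).
Proof.
by move=> p q /(congr1 nf); rewrite -!(ordered_evalC x) !evK => /polyC_inj.
Qed.

(** Degrees in x add up, so r and s lie in k[y], and they are constants because
    degrees in y add up there. *)
Lemma presented_unit (r s : R) : r * s = 1 -> exists2 c : k, c != 0 & r = c%:A.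
Proof.
have addn_pred1 (m n : nat) :
  (0 < m -> 0 < n -> 1 = (m + n).-1 -> m = 1 /\ n = 1)%N by lia.
move=> rs1; have nf1 : nf 1 = 1%:P%:P.
  by rewrite -(evK 1%:P%:P) ordered_evalC rmorph1.
have nf0 : nf 0 = 0 by rewrite -(evK 0) -polyC0 ordered_evalC raddf0.
have nfr : nf r != 0.
  rewrite -nf0 (can_eq nfK); apply: contra_eq_neq rs1 => ->.
  by rewrite mul0r eq_sym oner_eq0.
have nfs : nf s != 0.
  rewrite -nf0 (can_eq nfK); apply: contra_eq_neq rs1 => ->.
  by rewrite mulr0 eq_sym oner_eq0.
have := nf_mul r s; rewrite rs1 nf1 => nfE.
have szE := size_star nfr nfs; rewrite -nfE polyC1 size_poly1 in szE.
move: (nfr) (nfs); rewrite -!size_poly_gt0 => szr szs.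
have [/eqP/size_poly1P[c nzc rE] /eqP/size_poly1P[d nzd sE]] :=
  addn_pred1 _ _ szr szs szE.
move: nfE; rewrite rE sE /star size_polyC nzc big_ord1 nderivn0 /= -polyCM.
move=> /polyC_inj cd.
have : size (c * d)%R = 1%N by rewrite -cd size_poly1.
rewrite size_mul //; move: (nzc) (nzd); rewrite -!size_poly_gt0 => szc szd szcd.
have [/eqP/size_poly1P[e nze cE] _] := addn_pred1 _ _ szc szd (esym szcd).
by exists e => //; rewrite -[r]nfK rE ordered_evalC cE horner_algC.
Qed.

Hypothesis char0 : [pchar k] =i pred0.

(** If P has degree n + 1 > 0 in X, the coefficient of X^n in P * y - y P is
    (n + 1) P_(n+1) y^2: the term i = 0 of the product cancels with y P, and
    those with i > 1 have degree less than n.  It is nonzero in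
    characteristic 0. *)
Lemma presented_centralizer (r : R) :
  r * y = y * r -> exists p, r = horner_alg y p.
Proof.
move=> /(congr1 nf); rewrite nf_mul nf_yM nf_y /star.
case szP: (size (nf r)) => [|[|n]].
- move/eqP: szP; rewrite size_poly_eq0 => /eqP rE _; exists 0.
  by rewrite -[r]nfK rE -polyC0 ordered_evalC.
- have /size_poly1P[c _ rE] : size (nf r) == 1 by rewrite szP.
  by move=> _; exists c; rewrite -[r]nfK rE ordered_evalC.
rewrite 2!big_ord_recl nderivn0 nderivn1 /= mulrC mul_polyC => /eqP.
rewrite -subr_eq0 addrAC subrr add0r => /eqP/polyP/(_ n)/eqP.
rewrite coef0 coefD coef_sum big1 => [|i _]; last first.
  rewrite -!iterS iter_coef_jderivC coefMC [_`_n]nth_default ?mul0r //.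
  by apply: leq_trans (size_poly _ _) _; rewrite szP /bump /=; lia.
rewrite addr0 coef_jderivC coefMC coef_deriv /jderiv derivX mulr1 mulf_eq0.
rewrite expf_eq0 polyX_eq0 orbF.
rewrite -mulr_natr mulf_eq0 -polyC_natr polyC_eq0 ((pcharf0P k).1 char0) orbF.
have : lead_coef (nf r) != 0 by rewrite lead_coef_eq0 -size_poly_eq0 szP.
by rewrite lead_coefE szP => /negPf->.
Qed.

End Presented.
End NormalForm.

(** * Automorphisms *)

Section Automorphisms.
Variables (k : fieldType) (R : algType k) (x y : R).
Hypothesis presR : jordan_presented x y.

Lemma presented_ext (A : algType k) (f g : {lrmorphism R -> A}) :
  f x = g x -> f y = g y -> f =1 g.
Proof.
move=> fgx fgy; elim/(presented_ind presR) => [|c r s IHr IHs|r IHr|r IHr].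
- by rewrite !rmorph1.
- by rewrite !linearD !linearZ_LR /= IHr IHs.
- by rewrite !rmorphM /= fgx IHr.
- by rewrite !rmorphM /= fgy IHr.
Qed.

(** The kernel of the morphism x |-> X, y |-> 0 is yR: modulo yR every element
    is a polynomial in x, because xy = y(x + y). *)
Lemma residue_mod_y : exists h : {lrmorphism R -> {poly k}},
  h y = 0 /\ forall r, exists s, r = y * s + horner_alg x (h r).
Proof.
have rel0 : jordan_rel ('X : {poly k}) 0 = 0.
  by rewrite /jordan_rel mulr0 mul0r expr0n !subrr.
have [h [hx hy]] := presented_lift presR rel0; exists h; split=> //.
elim/(presented_ind presR) => [|c r s [r' rE] [s' sE]|r [r' rE]|r [r' rE]].
- by exists 0; rewrite !rmorph1 mulr0 add0r.
- exists (c *: r' + s'); rewrite {1}rE {1}sE (linearP h) rmorphD /= horner_algZ.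
  by rewrite scalerDr mulrDr -scalerAr addrACA.
- exists ((x + y) * r'); rewrite rmorphM rmorphM /= hx horner_algX {1}rE.
  by rewrite mulrDr !mulrA (presented_rel presR) mulrDr expr2.
- by exists r; rewrite rmorphM /= hy mul0r raddf0 addr0.
Qed.

(** Modulo y, the square f(y)^2 = [f(x), f(y)] vanishes by commutativity of
    k[X], hence so does f(y). *)
Lemma endo_y (f : {lrmorphism R -> R}) : exists u, f y = y * u.
Proof.
have [h [hy hE]] := residue_mod_y; have [s fyE] := hE (f y).
suff hfy : h (f y) = 0 by exists s; rewrite fyE hfy raddf0 addr0.
have := presented_rel presR => /(congr1 f) /(congr1 h) /eqP.
rewrite !(rmorphXn, rmorphD, rmorphM) /= mulrC -subr_eq0 opprD addrA subrr.
by rewrite sub0r oppr_eq0 expf_eq0 /= => /eqP.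
Qed.

Lemma aut_form (char0 : [pchar k] =i pred0) (f : alg_aut R) :
  exists (alpha : k) (p : {poly k}),
    [/\ alpha != 0, f x = alpha *: x + horner_alg y p & f y = alpha *: y].
Proof.
have [u fyE] := endo_y f; have [v gyE] := endo_y (aut_inv f).
have /(presented_unit presR)[alpha nz_alpha uE] : u * f v = 1.
  apply: (y_lreg presR); rewrite mulrA -fyE mulr1 -rmorphM -gyE.
  exact: (aut_invKV f).
have {}fyE : f y = alpha *: y by rewrite fyE uE -scalerAr mulr1.
have /(presented_centralizer presR char0)[p pE] :
  (f x - alpha *: x) * y = y * (f x - alpha *: x).
  have := presented_rel presR => /(congr1 f).
  rewrite !(rmorphXn, rmorphD, rmorphM) /= fyE exprZn expr2.
  rewrite -scalerAr -scalerAl -scalerA -scalerDr.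
  move/(scalerI nz_alpha); rewrite mulrBl mulrBr => ->.
  rewrite -scalerAl -scalerAr (presented_rel presR) scalerDr expr2 opprD.
  by rewrite addrACA subrr addr0.
by exists alpha, p; rewrite -pE addrC subrK.
Qed.

Lemma jordan_endo (alpha : k) (p : {poly k}) : exists f : {lrmorphism R -> R},
  f x = alpha *: x + horner_alg y p /\ f y = alpha *: y.
Proof.
apply: (presented_lift presR); rewrite /jordan_rel.
rewrite mulrDl mulrDr exprZn -!scalerAl -!scalerAr comm_horner_alg !scalerA.
rewrite (presented_rel presR) scalerDr !expr2 [_ *: (y * x) + _ + _]addrAC.
by rewrite [_ - (_ + _)]addrAC subrr add0r subrr.
Qed.

Lemma jordan_aut_exists (alpha : k) (p : {poly k}) : alpha != 0 ->
  exists f : alg_aut R, f x = alpha *: x + horner_alg y p /\ f y = alpha *: y.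
Proof.
move=> nz_alpha; have [f [fx fy]] := jordan_endo alpha p.
(* the polynomial q with q(alpha y) = - alpha^-1 p(y) makes f \o g fix x *)
have [g [gx gy]] :=
  jordan_endo alpha^-1 (- alpha^-1 *: (p \Po (alpha^-1 *: 'X))).
have fgK : cancel g f.
  apply: (presented_ext (f := f \o g) (g := idfun)); rewrite /= ?gx ?gy.
    rewrite rmorphD /= linearZ_LR /= fx rmorph_horner_alg fy horner_alg_scale.
    rewrite comp_polyZ -comp_polyA comp_polyZ comp_polyX scalerA mulVf //.
    rewrite scale1r comp_polyXr horner_algZ scalerDr scalerA mulVf // scale1r.
    by rewrite scaleNr -addrA subrr addr0.
  by rewrite linearZ_LR /= fy scalerA mulVf // scale1r.
have gfK : cancel f g.
  apply: (presented_ext (f := g \o f) (g := idfun)); rewrite /= ?fx ?fy.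
    rewrite rmorphD /= linearZ_LR /= gx rmorph_horner_alg gy horner_alg_scale.
    rewrite horner_algZ scalerDr !scalerA mulrN mulfV // scale1r scaleN1r.
    by rewrite -addrA addNr addr0.
  by rewrite linearZ_LR /= gy scalerA mulfV // scale1r.
have f_monoid : monoid_morphism f.
  by split; [exact: rmorph1 | exact: rmorphM].
exists (AlgAut (linearP f) f_monoid (Bijective gfK fgK)).
by split.
Qed.

Definition jordan_aut (alpha : mulgroup k) (p : {poly k}) : alg_aut R :=
  sval (cid (jordan_aut_exists p (valP alpha))).

Lemma jordan_autX alpha p :
  jordan_aut alpha p x = val alpha *: x + horner_alg y p.
Proof. by rewrite /jordan_aut; case: cid => f []. Qed.
Lemma jordan_autY alpha p : jordan_aut alpha p y = val alpha *: y.
Proof. by rewrite /jordan_aut; case: cid => f []. Qed.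

Lemma alg_aut_ext (f g : alg_aut R) : f x = g x -> f y = g y -> f = g.
Proof. by move=> fgx fgy; apply/aut_ext/presented_ext. Qed.

(** Conjugating x |-> x + p(y) by the scaling of x and y by alpha gives
    x |-> x + alpha^-1 p(alpha y). *)
Definition twist (alpha : mulgroup k) (p : {poly k}) : {poly k} :=
  (val alpha)^-1 *: (p \Po (val alpha *: 'X)).

Lemma twistD alpha : {morph twist alpha : p q / p + q}.
Proof. by move=> p q; rewrite /twist comp_polyD scalerDr. Qed.
Lemma twist1 p : twist 1%g p = p.
Proof. by rewrite /twist invr1 !scale1r comp_polyXr. Qed.
Lemma twistM alpha beta p :
  twist (alpha * beta)%g p = twist alpha (twist beta p).
Proof.
rewrite /twist comp_polyZ -comp_polyA comp_polyZ comp_polyX !scalerA /=.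
by rewrite invfM [val beta * _]mulrC.
Qed.

Definition twist_action : add_action (mulgroup k) {poly k} :=
  AddAction twistD twist1 twistM.

(** The factor alpha in front of p comes from (p, alpha) = (p, 1) * (0, alpha):
    the scaling is applied first, then x |-> x + p(y). *)
Definition semidirect_aut (u : semidirect twist_action) : alg_aut R :=
  jordan_aut u.2 (val u.2 *: u.1).

Lemma semidirect_autX u :
  semidirect_aut u x = val u.2 *: (x + horner_alg y u.1).
Proof. by rewrite [LHS]jordan_autX horner_algZ scalerDr. Qed.
Lemma semidirect_autY u : semidirect_aut u y = val u.2 *: y.
Proof. exact: jordan_autY. Qed.

Lemma semidirect_autM : {morph semidirect_aut : u v / (u * v)%g}.
Proof.
move=> u v; have mulE r : (semidirect_aut u * semidirect_aut v)%g r
  = semidirect_aut u (semidirect_aut v r) by [].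
apply: alg_aut_ext; rewrite mulE.
  rewrite !semidirect_autX linearZ_LR [in RHS]rmorphD /= semidirect_autX.
  rewrite rmorph_horner_alg /= semidirect_autY horner_alg_scale.
  rewrite /twist rmorphD /= horner_algZ !scalerDr !scalerA -!addrA.
  by rewrite [sval u.2 * _]mulrC mulfK ?(valP u.2).
by rewrite !semidirect_autY linearZ_LR /= semidirect_autY scalerA mulrC.
Qed.

HB.instance Definition _ := boot.monoid.isMultiplicative.Build
  (semidirect twist_action) (alg_aut R) semidirect_aut semidirect_autM.

Lemma semidirect_aut_inj : injective semidirect_aut.
Proof.
move=> [p alpha] [q beta] fE.
have /(congr1 (fun f : alg_aut R => f y)) := fE.
rewrite !semidirect_autY /= => abE.
have {abE} : alpha = beta.
  apply: val_inj; apply/eqP; rewrite -subr_eq0.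
  have : (val alpha - val beta) *: y == 0 by rewrite scalerBl abE subrr.
  by rewrite scaler_eq0 (negPf (presented_y_neq0 presR)) orbF.
move=> abE; rewrite abE in fE *.
have /(congr1 (fun f : alg_aut R => f x)) := fE; rewrite !semidirect_autX /=.
by move/(scalerI (valP beta))/addrI/(horner_alg_inj presR) => ->.
Qed.

Lemma semidirect_aut_bij (char0 : [pchar k] =i pred0) :
  bijective semidirect_aut.
Proof.
have surj f : exists u, semidirect_aut u == f.
  have [alpha [p [nz_alpha fx fy]]] := aut_form char0 f.
  exists (alpha^-1 *: p, exist _ alpha nz_alpha); apply/eqP/alg_aut_ext.
    by rewrite semidirect_autX /= scalerDr horner_algZ scalerA mulfV // scale1r.
  by rewrite semidirect_autY.
pose g f := xchoose (surj f).
have gK : cancel g semidirect_aut by move=> f; apply/eqP/(xchooseP (surj f)).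
exact: Bijective (inj_can_sym gK semidirect_aut_inj) gK.
Qed.
End Automorphisms.

Theorem theorem3p4 (k : closedFieldType) (char0 : [pchar k] =i pred0) :
  [/\ (forall f : alg_aut (jordan_plane k),
         exists (alpha : k) (p : {poly k}),
           [/\ alpha != 0,
               f jpX = alpha *: jpX + horner_alg jpY p
             & f jpY = alpha *: jpY]),
      (forall (alpha : k) (p : {poly k}), alpha != 0 ->
         exists f : alg_aut (jordan_plane k),
           f jpX = alpha *: jpX + horner_alg jpY p /\ f jpY = alpha *: jpY)
    & exists (phi : add_action (mulgroup k) {poly k})
             (Phi : {multiplicative semidirect phi -> alg_aut (jordan_plane k)}),
        [/\ bijective Phi,
            (forall p : {poly k},
               Phi (p, 1%g) jpX = jpX + horner_alg jpY p /\
               Phi (p, 1%g) jpY = jpY)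
          & (forall alpha : mulgroup k,
               Phi (0, alpha) jpX = val alpha *: jpX /\
               Phi (0, alpha) jpY = val alpha *: jpY)]].
Proof.
have pres := jordan_plane_presented k.
split; [exact: aut_form | exact: jordan_aut_exists |].
exists (twist_action k), (semidirect_aut pres : {multiplicative _ -> _}).
split=> [|p|alpha]; first exact: semidirect_aut_bij.
  by rewrite !semidirect_autX !semidirect_autY !scale1r.
by rewrite !semidirect_autX !semidirect_autY /= raddf0 addr0.
Qed.
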